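(* The generators $\sigma_1,\sigma_2,\tau_1,\tau_2$ of $SG_3$ act by conjugation on the generators $a_{12},a_{13},a_{23},b_{12},b_{13},b_{23}$ of the singular pure braid group $SP_3$ by the following rules. Action of $\sigma_1$: $$a_{12}^{\sigma_1}=a_{12},\quad a_{13}^{\sigma_1}=a_{13}a_{23}a_{13}^{-1},\quad a_{23}^{\sigma_1}=a_{13},$$ $$b_{12}^{\sigma_1}=b_{12},\quad b_{13}^{\sigma_1}=a_{13}b_{23}a_{13}^{-1},\quad b_{23}^{\sigma_1}=b_{13}.$$ Action of $\sigma_2$: $$a_{12}^{\sigma_2}=a_{23}^{-1}a_{13}a_{23},\quad a_{13}^{\sigma_2}=a_{12},\quad a_{23}^{\sigma_2}=a_{23},$$ $$b_{12}^{\sigma_2}=a_{23}^{-1}b_{13}a_{23},\quad b_{13}^{\sigma_2}=b_{12},\quad b_{23}^{\sigma_2}=b_{23}.$$ Action of $\tau_1$: $$a_{12}^{\tau_1}=a_{12},\quad a_{13}^{\tau_1}=b_{12}^{-1}a_{23}b_{12},\quad a_{23}^{\tau_1}=b_{12}^{-1}a_{23}^{-1}a_{13}a_{23}b_{12},$$ $$b_{12}^{\tau_1}=b_{12},\quad b_{13}^{\tau_1}=b_{12}^{-1}b_{23}b_{12},\quad b_{23}^{\tau_1}=b_{12}^{-1}a_{12}b_{13}a_{12}^{-1}b_{12}.$$ Action of $\tau_2$: $$a_{12}^{\tau_2}=b_{23}^{-1}a_{13}b_{23},\quad a_{13}^{\tau_2}=b_{23}^{-1}a_{23}a_{12}a_{23}^{-1}b_{23},\quad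 a_{23}^{\tau_2}=a_{23},$$ $$b_{12}^{\tau_2}=b_{23}^{-1}b_{13}b_{23},\quad b_{13}^{\tau_2}=b_{23}^{-1}a_{23}b_{12}a_{23}^{-1}b_{23},\quad b_{23}^{\tau_2}=b_{23}.$$
   Context: The singular braid group $SG_3$ is the group with generators $\sigma_1,\sigma_2,\tau_1,\tau_2$ and defining relations $$\sigma_1\sigma_2\sigma_1=\sigma_2\sigma_1\sigma_2,\quad \sigma_1\tau_1=\tau_1\sigma_1,\quad \sigma_2\tau_2=\tau_2\sigma_2,\quad \sigma_1\sigma_2\tau_1=\tau_2\sigma_1\sigma_2,\quad \sigma_2\sigma_1\tau_2=\tau_1\sigma_2\sigma_1.$$ The singular pure braid group $SP_3$ is the kernel of the homomorphism $\pi:SG_3\to S_3$ onto the symmetric group with $\pi(\sigma_i)=\pi(\tau_i)=(i,i+1)$ for $i=1,2$; it is generated by $$a_{12}=\sigma_1^2,\quad a_{13}=\sigma_2\sigma_1^2\sigma_2^{-1},\quad a_{23}=\sigma_2^2,\quad b_{12}=\sigma_1\tau_1,\quad b_{13}=\sigma_2\sigma_1\tau_1\sigma_2^{-1},\quad b_{23}=\sigma_2\tau_2.$$ Notation: $x^g=g^{-1}xg$. *)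

(* Defs.v *)
From HB Require Import structures.
From mathcomp Require Import all_boot all_fingroup generic_quotient boolp.

Set Implicit Arguments.
Unset Strict Implicit.
Unset Printing Implicit Defensive.

Local Open Scope group_scope.

(* The letter [(x, false)] stands for the generator [x], and [(x, true)] for
   its formal inverse. *)
Definition word (X : Type) := seq (X * bool).

Definition winv (X : Type) (w : word X) : word X :=
  [seq (l.1, ~~ l.2) | l <- rev w].

(* The smallest congruence on words that contains the relations [rels] (a pair
   [(u, v)] being the relation [u = v]) and the free cancellations. *)
Inductive pres_eq (X : eqType) (rels : seq (word X * word X)) :
    word X -> word X -> Prop :=
| pres_refl u : pres_eq rels u u
| pres_sym u v : pres_eq rels u v -> pres_eq rels v u
| pres_trans v u w : pres_eq rels u v -> pres_eq rels v w -> pres_eq rels u w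
| pres_cat u u' v v' :
    pres_eq rels u u' -> pres_eq rels v v' -> pres_eq rels (u ++ v) (u' ++ v')
| pres_cancel x b : pres_eq rels [:: (x, b); (x, ~~ b)] [::]
| pres_rel r : r \in rels -> pres_eq rels r.1 r.2.

Definition pres_eqb (X : eqType) (rels : seq (word X * word X)) : rel (word X) :=
  fun u v => `[< pres_eq rels u v >].

Section Presented.
Context (X : choiceType) (rels : seq (word X * word X)).
Local Notation eqw := (pres_eq rels).

Lemma pres_eqb_equiv : equiv_class_of (pres_eqb rels).
Proof.
split.
- by move=> u; apply/asboolP/pres_refl.
- by move=> u v; apply/asboolP/asboolP; apply: pres_sym.
- by move=> v u w /asboolP uv /asboolP vw; apply/asboolP/(pres_trans uv).
Qed.

Canonical pres_equiv := EquivRelPack pres_eqb_equiv.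

Definition presented : Type := {eq_quot pres_equiv}%qT.
HB.instance Definition _ := Choice.copy presented {eq_quot pres_equiv}%qT.

Definition pres_class (w : word X) : presented := \pi_({eq_quot pres_equiv})%qT w.
Definition pres_repr (q : presented) : word X :=
  repr (q : {eq_quot pres_equiv}%qT).

Lemma pres_classP u v : pres_class u = pres_class v <-> eqw u v.
Proof.
split=> [|uv]; first by move/eqquotP/asboolP.
by apply/eqquotP/asboolP.
Qed.

Lemma pres_reprK : cancel pres_repr pres_class.
Proof. exact: reprK. Qed.

Lemma eqw_repr w : eqw (pres_repr (pres_class w)) w.
Proof. by apply/pres_classP; rewrite pres_reprK. Qed.

Lemma winvK : involutive (@winv X).
Proof.
move=> w; rewrite /winv -map_rev revK -map_comp map_id_in // => -[x b] _ /=.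
by rewrite negbK.
Qed.

Lemma eqw_winvl w : eqw (winv w ++ w) [::].
Proof.
elim: w => [|[x b] w IH]; first exact: pres_refl.
rewrite /winv rev_cons map_rcons -cats1 -catA /=.
apply: pres_trans IH; apply: pres_cat; first exact: pres_refl.
have := @pres_cat _ rels [:: (x, ~~ b); (x, ~~ ~~ b)] [::] w w.
by rewrite negbK /=; apply; [rewrite -{2}[b]negbK; apply: pres_cancel | apply: pres_refl].
Qed.

Lemma eqw_winvr w : eqw (w ++ winv w) [::].
Proof. by rewrite -{1}(winvK w); apply: eqw_winvl. Qed.

Lemma eqw_winv u v : eqw u v -> eqw (winv u) (winv v).
Proof.
move=> uv; apply: (@pres_trans _ _ (winv u ++ (v ++ winv v))).
  rewrite -{1}[winv u]cats0; apply: pres_cat; first exact: pres_refl.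
  exact/pres_sym/eqw_winvr.
rewrite catA -[in X in eqw _ X](cat0s (winv v)).
apply: pres_cat; last exact: pres_refl.
apply: pres_trans (eqw_winvl u); apply: pres_cat; first exact: pres_refl.
exact: pres_sym.
Qed.

Definition pres_one : presented := pres_class [::].
Definition pres_mul (p q : presented) : presented :=
  pres_class (pres_repr p ++ pres_repr q).
Definition pres_inv (p : presented) : presented :=
  pres_class (winv (pres_repr p)).

Lemma pres_classM u v :
  pres_class (u ++ v) = pres_mul (pres_class u) (pres_class v).
Proof. by apply/pres_classP/pres_cat; apply/pres_sym/eqw_repr. Qed.

Lemma pres_classV u : pres_class (winv u) = pres_inv (pres_class u).
Proof. by apply/pres_classP/eqw_winv/pres_sym/eqw_repr. Qed.

Fact pres_mulA : associative pres_mul.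
Proof.
move=> p q r; rewrite -(pres_reprK p) -(pres_reprK q) -(pres_reprK r).
by rewrite -!pres_classM catA.
Qed.

Fact pres_mul1 : left_id pres_one pres_mul.
Proof. by move=> p; rewrite -(pres_reprK p) -pres_classM. Qed.

Fact pres_mulr1 : right_id pres_one pres_mul.
Proof. by move=> p; rewrite -(pres_reprK p) -pres_classM cats0. Qed.

Fact pres_mulV : left_inverse pres_one pres_inv pres_mul.
Proof.
move=> p; rewrite -(pres_reprK p) -pres_classV -pres_classM.
exact/pres_classP/eqw_winvl.
Qed.

Fact pres_mulrV : right_inverse pres_one pres_inv pres_mul.
Proof.
move=> p; rewrite -(pres_reprK p) -pres_classV -pres_classM.
exact/pres_classP/eqw_winvr.
Qed.

HB.instance Definition _ :=
  isGroup.Build presented pres_mulA pres_mul1 pres_mulr1 pres_mulV pres_mulrV.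

Definition pres_gen (x : X) : presented := pres_class [:: (x, false)].

Definition letter_eval (H : groupType) (f : X -> H) (l : X * bool) : H :=
  if l.2 then (f l.1)^-1 else f l.1.

Definition word_eval (H : groupType) (f : X -> H) (w : word X) : H :=
  \prod_(l <- w) letter_eval f l.

(* This is a homomorphism as soon as [f] satisfies the relations, see
   [pres_liftM] and [pres_lift_gen]. *)
Definition pres_lift (H : groupType) (f : X -> H) (q : presented) : H :=
  word_eval f (pres_repr q).

Section Lift.
Context (H : groupType) (f : X -> H)
  (f_rels : {in rels, forall r, word_eval f r.1 = word_eval f r.2}).

Lemma word_eval_eqw u v : eqw u v -> word_eval f u = word_eval f v.
Proof.
elim=> //.
- by move=> {}v {}u w _ -> _ ->.
- move=> {}u u' {}v v' _ IHu _ IHv.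
  by rewrite /word_eval !big_cat /= -!/(word_eval f _) IHu IHv.
- move=> x b; rewrite /word_eval !big_cons !big_nil mulg1 /letter_eval /=.
  by case: b; rewrite /= ?mulVg ?mulgV.
Qed.

Lemma pres_lift_class w : pres_lift f (pres_class w) = word_eval f w.
Proof. exact/word_eval_eqw/eqw_repr. Qed.

Lemma pres_liftM : {morph pres_lift f : p q / p * q}.
Proof.
move=> p q; rewrite -(pres_reprK p) -(pres_reprK q) -[_ * _]pres_classM.
by rewrite !pres_lift_class /word_eval big_cat.
Qed.

Lemma pres_lift1 : pres_lift f 1 = 1.
Proof. by rewrite -[1]/(pres_class [::]) pres_lift_class /word_eval big_nil. Qed.

Lemma pres_lift_gen x : pres_lift f (pres_gen x) = f x.
Proof. by rewrite pres_lift_class /word_eval big_seq1. Qed.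

End Lift.
End Presented.

Inductive SG3_gen := Sigma1 | Sigma2 | Tau1 | Tau2.

Definition SG3_gen_code (x : SG3_gen) : bool * bool :=
  match x with
  | Sigma1 => (false, false) | Sigma2 => (false, true)
  | Tau1 => (true, false) | Tau2 => (true, true)
  end.
Definition SG3_gen_decode (c : bool * bool) : SG3_gen :=
  match c with
  | (false, false) => Sigma1 | (false, true) => Sigma2
  | (true, false) => Tau1 | (true, true) => Tau2
  end.
Lemma SG3_gen_codeK : cancel SG3_gen_code SG3_gen_decode.
Proof. by case. Qed.
HB.instance Definition _ := Countable.copy SG3_gen (can_type SG3_gen_codeK).

Definition positive (s : seq SG3_gen) : word SG3_gen := [seq (x, false) | x <- s].

Definition SG3_rels : seq (word SG3_gen * word SG3_gen) :=
  [:: (positive [:: Sigma1; Sigma2; Sigma1], positive [:: Sigma2; Sigma1; Sigma2]);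
      (positive [:: Sigma1; Tau1], positive [:: Tau1; Sigma1]);
      (positive [:: Sigma2; Tau2], positive [:: Tau2; Sigma2]);
      (positive [:: Sigma1; Sigma2; Tau1], positive [:: Tau2; Sigma1; Sigma2]);
      (positive [:: Sigma2; Sigma1; Tau2], positive [:: Tau1; Sigma2; Sigma1])].

Definition SG3 : Type := presented SG3_rels.
HB.instance Definition _ := Group.copy SG3 (presented SG3_rels).

Definition sigma1 : SG3 := pres_gen SG3_rels Sigma1.
Definition sigma2 : SG3 := pres_gen SG3_rels Sigma2.
Definition tau1 : SG3 := pres_gen SG3_rels Tau1.
Definition tau2 : SG3 := pres_gen SG3_rels Tau2.

Lemma SG3_relations :
  [/\ sigma1 * sigma2 * sigma1 = sigma2 * sigma1 * sigma2,
      sigma1 * tau1 = tau1 * sigma1,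
      sigma2 * tau2 = tau2 * sigma2,
      sigma1 * sigma2 * tau1 = tau2 * sigma1 * sigma2 &
      sigma2 * sigma1 * tau2 = tau1 * sigma2 * sigma1].
Proof.
have rel u v : (u, v) \in SG3_rels -> pres_class SG3_rels u = pres_class SG3_rels v.
  by move/pres_rel/pres_classP.
have mulE u v : (pres_class SG3_rels u : SG3) * pres_class SG3_rels v
              = pres_class SG3_rels (u ++ v).
  by rewrite pres_classM.
by split; rewrite /sigma1 /sigma2 /tau1 /tau2 /pres_gen !mulE; apply: rel.
Qed.

(* The strands 1, 2, 3 are numbered 0, 1, 2 in ['I_3]. *)
Definition strand1 : 'I_3 := @Ordinal 3 0 isT.
Definition strand2 : 'I_3 := @Ordinal 3 1 isT.
Definition strand3 : 'I_3 := @Ordinal 3 2 isT.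

Definition SG3_gen_perm (x : SG3_gen) : 'S_3 :=
  match x with
  | Sigma1 | Tau1 => tperm strand1 strand2
  | Sigma2 | Tau2 => tperm strand2 strand3
  end.

Lemma tperm_braid :
  tperm strand1 strand2 * (tperm strand2 strand3 * tperm strand1 strand2) =
  tperm strand2 strand3 * (tperm strand1 strand2 * tperm strand2 strand3).
Proof.
by apply/permP => i; rewrite !permM !permE /=; case: i => -[|[|[|]]].
Qed.

Lemma SG3_gen_perm_rels :
  {in SG3_rels, forall r,
     word_eval SG3_gen_perm r.1 = word_eval SG3_gen_perm r.2}.
Proof.
move=> r; rewrite !inE => /or4P[/eqP|/eqP|/eqP|/orP[/eqP|/eqP]] ->;
  by rewrite /word_eval !big_cons !big_nil /letter_eval /= ?mulg1 // tperm_braid.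
Qed.

Definition pi3 (g : SG3) : 'S_3 := pres_lift SG3_gen_perm g.

Fact pi3_monoid_morphism : monoid_morphism pi3.
Proof.
by split; [apply: pres_lift1 | apply: pres_liftM]; apply: SG3_gen_perm_rels.
Qed.
HB.instance Definition _ := isUMagmaMorphism.Build SG3 'S_3 pi3 pi3_monoid_morphism.

Lemma pi3_gen :
  (pi3 sigma1 = tperm strand1 strand2) * (pi3 sigma2 = tperm strand2 strand3) *
  (pi3 tau1 = tperm strand1 strand2) * (pi3 tau2 = tperm strand2 strand3).
Proof. by do !split; apply: (pres_lift_gen SG3_gen_perm_rels). Qed.

Definition ker_pi3 : pred SG3 := fun g => pi3 g == 1.

Fact ker_pi3_group_closed : group_closed ker_pi3.
Proof.
split; first by rewrite unfold_in /ker_pi3 gmulf1.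
move=> x y; rewrite !unfold_in /ker_pi3 => /eqP px /eqP py.
by rewrite gmulfF /= px py divgg.
Qed.

Definition SP3 : Type := {g : SG3 | ker_pi3 g}.
HB.instance Definition _ := SubChoice.copy SP3 {g : SG3 | ker_pi3 g}.
HB.instance Definition _ :=
  SubChoice_isSubGroup.Build SG3 ker_pi3 SP3 ker_pi3_group_closed.

Fact a12_subproof : ker_pi3 (sigma1 ^+ 2).
Proof. by rewrite /ker_pi3 gmulfXn /= !pi3_gen expg2 tperm2. Qed.
Fact a13_subproof : ker_pi3 (sigma2 * sigma1 ^+ 2 * sigma2^-1).
Proof.
by rewrite /ker_pi3 !(gmulfM, gmulfV, gmulfXn) /= !pi3_gen tperm2 mulg1 mulgV.
Qed.
Fact a23_subproof : ker_pi3 (sigma2 ^+ 2).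
Proof. by rewrite /ker_pi3 gmulfXn /= !pi3_gen expg2 tperm2. Qed.
Fact b12_subproof : ker_pi3 (sigma1 * tau1).
Proof. by rewrite /ker_pi3 gmulfM /= !pi3_gen tperm2. Qed.
Fact b13_subproof : ker_pi3 (sigma2 * sigma1 * tau1 * sigma2^-1).
Proof.
by rewrite /ker_pi3 !(gmulfM, gmulfV) /= !pi3_gen -(mulgA (tperm strand2 _)) tperm2 mulg1 mulgV.
Qed.
Fact b23_subproof : ker_pi3 (sigma2 * tau2).
Proof. by rewrite /ker_pi3 gmulfM /= !pi3_gen tperm2. Qed.

Definition a12 : SP3 := exist _ (sigma1 ^+ 2) a12_subproof.
Definition a13 : SP3 := exist _ (sigma2 * sigma1 ^+ 2 * sigma2^-1) a13_subproof.
Definition a23 : SP3 := exist _ (sigma2 ^+ 2) a23_subproof.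
Definition b12 : SP3 := exist _ (sigma1 * tau1) b12_subproof.
Definition b13 : SP3 := exist _ (sigma2 * sigma1 * tau1 * sigma2^-1) b13_subproof.
Definition b23 : SP3 := exist _ (sigma2 * tau2) b23_subproof.

Fact SP3_conj_subproof (x : SP3) (g : SG3) : ker_pi3 (val x ^ g).
Proof.
by have /eqP px := valP x; rewrite /ker_pi3 gmulfJ /= px conj1g.
Qed.

(* [SG3] acts by conjugation on its normal subgroup [SP3]; in MathComp
   [x ^ g] is [g^-1 * (x * g)]. *)
Definition SP3_conj (x : SP3) (g : SG3) : SP3 :=
  exist _ (val x ^ g) (SP3_conj_subproof x g).

Notation "x ^^ g" := (SP3_conj x g) (at level 30, right associativity) : group_scope.

(* Main.v *)
Require Import Defs.
From mathcomp Require Import all_boot all_fingroup.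

Set Implicit Arguments.
Unset Strict Implicit.

Local Open Scope group_scope.

(** Write [s, t] for [sigma1, sigma2]. The rules for the [a_ij] and those for
    the [b_ij] are instances of the same rules, about triples [(u, u ^ t^-1, v)]
    such that [u] commutes with [s], [v] commutes with [t], conjugation by
    [t * s] sends [u] to [v] and conjugation by [s * t] sends [v] to [u]. The
    pair [(s, t)] has these properties because of the braid relation, and
    [(tau1, tau2)] because of the four relations on the [tau_i]; they pass to
    products ([linkedM]), hence to [(a12, a23) = (s ^+ 2, t ^+ 2)] and to
    [(b12, b23) = (s * tau1, t * tau2)].

    For such a pair the middle element [u ^ t^-1] is also [v ^ s]
    ([linked_mid]), so conjugation by [s] moves [v] to the middle, and
    conjugation by [t] moves the middle to [u]. Conjugation by [t] moves [u] to
    the conjugate of the middle by [t ^+ 2], because [t = t^-1 * t ^+ 2]. Only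
    the image of the middle under [s] asks for a further use of the braid
    relation ([linked_mid_conj_s]).

    Finally [tau1 = s^-1 * b12] and [tau2 = t^-1 * b23], so the rules for the
    [tau_i] are the rules for the inverses of the [sigma_i] followed by
    conjugation by [b12] or [b23]. *)

Section LinkedPairs.
Context {G : groupType} (s t : G).

Definition linked (u v : G) : Prop :=
  [/\ commute u s, commute v t, u ^ (t * s) = v & v ^ (s * t) = u].

Lemma linkedM u v u' v' :
  linked u v -> linked u' v' -> linked (u * u') (v * v').
Proof.
move=> [us vt uv vu] [us' vt' uv' vu'].
by split; rewrite ?conjMg ?uv ?uv' ?vu ?vu' //; apply/commute_sym/commuteM;
  apply: commute_sym.
Qed.

Lemma conjg_of_mul (g x y : G) : g * y = x * g -> x ^ g = y.
Proof. by move=> gy; apply: (mulgI g); rewrite -conjgC gy. Qed.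

Hypothesis braid : s * t * s = t * s * t.

Lemma linked_braid : linked s t.
Proof. by split=> //; apply: conjg_of_mul; rewrite !mulgA braid. Qed.

Lemma linked_mid u v : linked u v -> u ^ t^-1 = v ^ s.
Proof. by case=> _ _ _ <-; rewrite conjgM conjgK. Qed.

Lemma linked_mid_back u v : linked u v -> v ^ s^-1 = u ^ t.
Proof. by case=> _ _ <- _; rewrite conjgM conjgK. Qed.

(** Expand [((s ^+ 2) ^ t^-1)^-1] as [t * s^-1 * s^-1 * t^-1]. The first letter
    fixes [v], the second sends it to [u ^ t] by [linked_mid_back], and the braid
    relation turns the remaining [t * s^-1 * t^-1] into [s^-1 * t^-1 * s], whose
    first letter fixes [u]. *)
Lemma linked_mid_conj_s u v :
  linked u v -> (u ^ t^-1) ^ s = v ^ ((s ^+ 2) ^ t^-1)^-1.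
Proof.
move=> uv; have [us vt _ _] := uv.
have usV : u ^ s^-1 = u by apply: conjg_of_mul; apply/commute_sym/commuteV.
have braidV : t * (s^-1 * t^-1) = s^-1 * t^-1 * s.
  apply: (mulgI (t * s)); apply: (mulIg t).
  rewrite -!mulgA mulVg mulg1 mulKVg mulKVg.
  by rewrite !mulgA -braid mulgK.
rewrite -conjVg [(s ^+ 2)^-1 ^ _]conjgE invgK expg2 invgM !conjgM.
have -> : v ^ t = v by apply: conjg_of_mul.
rewrite (linked_mid_back uv) -(conjgM _ s^-1) -(conjgM _ t) braidV.
by rewrite !conjgM usV.
Qed.

Lemma sigma1_rules u v : linked u v ->
  let w := u ^ t^-1 in let a13 := (s ^+ 2) ^ t^-1 in
  [/\ u ^ s = u, w ^ s = a13 * v * a13^-1 & v ^ s = w].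
Proof.
move=> uv w a13; have [us _ _ _] := uv; split.
- exact: conjg_of_mul.
- by rewrite (linked_mid_conj_s uv) conjgE invgK mulgA.
- by rewrite -(linked_mid uv).
Qed.

Lemma sigma2_rules u v : linked u v ->
  let w := u ^ t^-1 in let a23 := t ^+ 2 in
  [/\ u ^ t = a23^-1 * w * a23, w ^ t = u & v ^ t = v].
Proof.
move=> [_ vt _ _] w a23; split; [|exact: conjgKV|exact: conjg_of_mul].
by rewrite -mulgA -conjgE -[w ^ _]conjgM /a23 expg2 mulKg.
Qed.

(** Two forms are given for [v ^ p]: conjugating the middle by [t ^+ 2] or by
    [s ^- 2] yields the same element [u ^ t = v ^ s^-1], and the rules for
    [a23] and [b23] use one form each. *)
Lemma tau1_rules (p : G) u v : linked u v ->
  let w := u ^ t^-1 in let b12 := s * p in let a12 := s ^+ 2 in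
  let a23 := t ^+ 2 in commute u b12 ->
  [/\ u ^ p = u, w ^ p = b12^-1 * v * b12,
      v ^ p = b12^-1 * a23^-1 * w * a23 * b12 &
      v ^ p = b12^-1 * a12 * w * a12^-1 * b12].
Proof.
move=> uv w b12 a12 a23 ub; have [us _ _ _] := uv.
have conj_p (x : G) : x ^ p = (x ^ s^-1) ^ b12 by rewrite -conjgM mulKg.
have conjE (x y g : G) : g^-1 * x^-1 * y * x * g = (y ^ x) ^ g.
  by rewrite !conjgE !mulgA.
have usV : u ^ s^-1 = u by apply: conjg_of_mul; apply/commute_sym/commuteV.
split.
- by rewrite conj_p usV; apply: conjg_of_mul.
- by rewrite conj_p /w (linked_mid uv) conjgK conjgE mulgA.
- by rewrite conj_p conjE (linked_mid_back uv) /w -[_ ^ a23]conjgM /a23 expg2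
    mulKg.
- rewrite conj_p -{1}[a12]invgK conjE /w (linked_mid uv) -(conjgM v s).
  by rewrite /a12 expg2 invgM mulKVg.
Qed.

Lemma tau2_rules (q : G) u v : linked u v ->
  let w := u ^ t^-1 in let b23 := t * q in let a23 := t ^+ 2 in
  commute v b23 ->
  [/\ u ^ q = b23^-1 * w * b23,
      w ^ q = b23^-1 * a23 * u * a23^-1 * b23 & v ^ q = v].
Proof.
move=> [_ vt _ _] w b23 a23 vb.
have conj_q (x : G) : x ^ q = (x ^ t^-1) ^ b23 by rewrite -conjgM mulKg.
have vtV : v ^ t^-1 = v by apply: conjg_of_mul; apply/commute_sym/commuteV.
split.
- by rewrite conj_q conjgE mulgA.
- by rewrite conj_q /w -[(u ^ _) ^ _]conjgM -invgM -expg2 !conjgE invgK !mulgA.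
- by rewrite conj_q vtV; apply: conjg_of_mul.
Qed.

End LinkedPairs.

Theorem proposition4p1 :
  ((a12 ^^ sigma1 = a12 /\
    a13 ^^ sigma1 = a13 * a23 * a13^-1 /\
    a23 ^^ sigma1 = a13) /\
   (b12 ^^ sigma1 = b12 /\
    b13 ^^ sigma1 = a13 * b23 * a13^-1 /\
    b23 ^^ sigma1 = b13)) /\
  ((a12 ^^ sigma2 = a23^-1 * a13 * a23 /\
    a13 ^^ sigma2 = a12 /\
    a23 ^^ sigma2 = a23) /\
   (b12 ^^ sigma2 = a23^-1 * b13 * a23 /\
    b13 ^^ sigma2 = b12 /\
    b23 ^^ sigma2 = b23)) /\
  ((a12 ^^ tau1 = a12 /\
    a13 ^^ tau1 = b12^-1 * a23 * b12 /\
    a23 ^^ tau1 = b12^-1 * a23^-1 * a13 * a23 * b12) /\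
   (b12 ^^ tau1 = b12 /\
    b13 ^^ tau1 = b12^-1 * b23 * b12 /\
    b23 ^^ tau1 = b12^-1 * a12 * b13 * a12^-1 * b12)) /\
  ((a12 ^^ tau2 = b23^-1 * a13 * b23 /\
    a13 ^^ tau2 = b23^-1 * a23 * a12 * a23^-1 * b23 /\
    a23 ^^ tau2 = a23) /\
   (b12 ^^ tau2 = b23^-1 * b13 * b23 /\
    b13 ^^ tau2 = b23^-1 * a23 * b12 * a23^-1 * b23 /\
    b23 ^^ tau2 = b23)).
Proof.
have [braid st1 st2 sst tss] := SG3_relations.
have linked_s := linked_braid braid.
have linked_t : linked sigma1 sigma2 tau1 tau2.
  by split; [exact/commute_sym|exact/commute_sym| |];
    apply: conjg_of_mul; rewrite !mulgA.
have linked_a := linkedM linked_s linked_s.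
have linked_b := linkedM linked_s linked_t.
rewrite -!expg2 in linked_a.
have -> : a13 = a12 ^^ sigma2^-1.
  by apply: val_inj; rewrite /= conjgE invgK !mulgA.
have -> : b13 = b12 ^^ sigma2^-1.
  by apply: val_inj; rewrite /= conjgE invgK !mulgA.
have a12b12 : commute (sigma1 ^+ 2) (sigma1 * tau1).
  by apply/commute_sym/commuteX/commute_sym/commuteM.
have a23b23 : commute (sigma2 ^+ 2) (sigma2 * tau2).
  by apply/commute_sym/commuteX/commute_sym/commuteM.
have [s1a12 s1a13 s1a23] := sigma1_rules braid linked_a.
have [s1b12 s1b13 s1b23] := sigma1_rules braid linked_b.
have [s2a12 s2a13 s2a23] := sigma2_rules linked_a.
have [s2b12 s2b13 s2b23] := sigma2_rules linked_b.
have [t1a12 t1a13 t1a23 _] := tau1_rules linked_a a12b12.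
have [t1b12 t1b13 _ t1b23] := tau1_rules linked_b (commute_refl _).
have [t2a12 t2a13 t2a23] := tau2_rules linked_a a23b23.
have [t2b12 t2b13 t2b23] := tau2_rules linked_b (commute_refl _).
by do !split; apply: val_inj; rewrite ?(gmulfM, gmulfV).
Qed.
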